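(* Let $k \geq 4$ be a fixed even integer. Then the following two implications hold. (i) For every $\varepsilon > 0$ there exist $\delta > 0$ and $n_0$ such that every tournament $T$ on $n \geq n_0$ vertices satisfying $$\sum_{v \in X} \left| d^+(v,Y) - d^-(v,Y) \right| \leq \delta n^2 \quad \text{for all } X, Y \subseteq V(T)$$ satisfies $\left| \mathrm{ec}_k(T) - \tfrac12 n^k \right| \leq \varepsilon n^k$. (ii) For every $\varepsilon > 0$ there exist $\delta > 0$ and $n_0$ such that every tournament $T$ on $n \geq n_0$ vertices satisfying $\left| \mathrm{ec}_k(T) - \tfrac12 n^k \right| \leq \delta n^k$ satisfies $$\sum_{v \in X} \left| d^+(v,Y) - d^-(v,Y) \right| \leq \varepsilon n^2 \quad \text{for all } X, Y \subseteq V(T).$$ In other words, a tournament satisfies property $\mathcal{Q}$ if and only if it satisfies property $\mathcal{P}(k)$.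
   Context: A tournament $T=(V,E)$ on $n=|V|$ vertices is a directed graph such that for any two distinct vertices $u,v$ exactly one of the directed edges $(u,v)$, $(v,u)$ is in $E$ (and there are no loops). For $Y \subseteq V$ and $v \in V$, $d^+(v,Y)$ is the number of edges $(v,y)\in E$ with $y \in Y$, and $d^-(v,Y)$ is the number of edges $(y,v)\in E$ with $y \in Y$. A $k$-cycle is an ordered sequence of vertices $(v_1, v_2, \ldots, v_k, v_1)$ (vertices may repeat) such that $v_i \neq v_{i+1}$ for all $i \leq k-1$ and $v_k \neq v_1$. A $k$-cycle is even if the number of indices $i \in \{1,\dots,k\}$ for which the edge between $v_i$ and $v_{i+1}$ (indices mod $k$, so $v_{k+1}=v_1$) is directed from $v_{i+1}$ to $v_i$ is even; otherwise it is odd. $\mathrm{ec}_k(T)$ denotes the number of even $k$-cycles in $T$. Property $\mathcal{Q}$ means $\sum_{v\in X}|d^+(v,Y)-d^-(v,Y)| = o(n^2)$ for all $X,Y\subseteq V$; property $\mathcal{P}(k)$ means $\mathrm{ec}_k(T) = (1/2 \pm o(1)) n^k$. *)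

(* Defs.v *)
From mathcomp Require Import all_boot all_order all_algebra.
From mathcomp Require Import reals.

Set Implicit Arguments.
Unset Strict Implicit.
Unset Printing Implicit Defensive.

Import Order.TTheory GRing.Theory Num.Theory.

Record tournament (V : finType) := Tournament {
  edge :> rel V;
  edge_irr : irreflexive edge;
  edge_xor : forall u v : V, u != v -> edge u v (+) edge v u
}.

Definition outdeg (V : finType) (T : tournament V) (v : V) (Y : {set V}) : nat :=
  #|[set y in Y | T v y]|.

Definition indeg (V : finType) (T : tournament V) (v : V) (Y : {set V}) : nat :=
  #|[set y in Y | T y v]|.

(* The sequence (v_1, ..., v_k, v_1) is encoded by c : 'I_k -> V, with
   v_(i+1) = c i; [ordS] is the cyclic successor, so repetitions of
   non-consecutive vertices are allowed and c (k-1) is followed by c 0. *)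
Definition is_cycle (V : finType) (k : nat) (c : {ffun 'I_k -> V}) : bool :=
  [forall i : 'I_k, c i != c (ordS i)].

Definition backward (V : finType) (T : tournament V) (k : nat)
    (c : {ffun 'I_k -> V}) : nat :=
  #|[set i : 'I_k | T (c (ordS i)) (c i)]|.

Definition even_cycle (V : finType) (T : tournament V) (k : nat)
    (c : {ffun 'I_k -> V}) : bool :=
  is_cycle c && ~~ odd (backward T c).

Definition ec (V : finType) (k : nat) (T : tournament V) : nat :=
  #|[set c : {ffun 'I_k -> V} | even_cycle T c]|.

Local Open Scope ring_scope.

Definition imbalance (R : realType) (V : finType) (T : tournament V)
    (X Y : {set V}) : R :=
  \sum_(v in X) `|(outdeg T v Y)%:R - (indeg T v Y)%:R|.

(* Main.v *)
(** Let [A] be the skew-symmetric matrix with entry [1] at [(u, v)] when [u -> v]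
    and [-1] when [v -> u].  Then [tr (A^k)] is the number of even minus the number
    of odd [k]-cycles, and all but [k n^(k-1)] of the [n^k] sequences are cycles, so
    [ec_k = n^k / 2 + o(n^k)] iff [tr (A^k) = o(n^k)].

    If [T] is balanced, fix all vertices of a closed walk but two consecutive ones
    [i, j], with [l] the vertex after [j]: the sum over [i, j] is at most
    [sum_i |sum_j A_ij A_jl|], an imbalance with [Y] the in- and the
    out-neighbourhood of [l].

    Conversely let [k = 2m].  An imbalance is [x^T A y] with entries of [x, y] at most
    [1] in absolute value, so its square is at most [n |A y|^2].  As [A] is skew, the
    sequence [|A^j y|^2] is log-convex in [j], whence
    [|A y|^(2m) <= |y|^(2m-2) |A^m y|^2 <= |y|^(2m) |tr (A^k)|], the last step
    because [|tr (A^(2m))|] is the squared Frobenius norm of [A^m]. *)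
Require Import Defs.
From mathcomp Require Import all_boot all_order all_algebra.
From mathcomp Require Import reals ring lra.
Import Order.TTheory GRing.Theory Num.Theory.
Local Open Scope ring_scope.

Set Implicit Arguments.
Unset Strict Implicit.
Unset Printing Implicit Defensive.

(** * Traces of matrix powers as sums over closed walks *)

Fixpoint walk_weight {R : pzSemiRingType} {I : Type} (F : I -> I -> R) (u : I) (s : seq I)
    (v : I) : R :=
  if s is x :: s' then F u x * walk_weight F x s' v else F u v.

(* The default value of [nth v s] supplies the endpoint [v] of the last step. *)
Lemma walk_weight_prod (R : pzSemiRingType) (I : Type) (F : I -> I -> R) u s v :
  walk_weight F u s v = \prod_(i < (size s).+1) F (nth v (u :: s) i) (nth v s i).
Proof.
elim: s u => [|x s IH] u /=; first by rewrite big_ord_recl big_ord0 mulr1.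
by rewrite big_ord_recl IH.
Qed.

Lemma sum_tupleS (R : nmodType) (I : finType) (k : nat) (F : k.+1.-tuple I -> R) :
  \sum_t F t = \sum_x \sum_(t : k.-tuple I) F [tuple of x :: t].
Proof.
rewrite pair_big (reindex (fun p : I * k.-tuple I => [tuple of p.1 :: p.2])) //=.
exists (fun t => (thead t, [tuple of behead t])) => [[x t] _|t _] /=.
  by rewrite theadE; congr (_, _); apply: val_inj.
by rewrite -tuple_eta.
Qed.

Lemma exprmx_walk (R : comPzRingType) (n k : nat) (M : 'M[R]_n) i j :
  (M ^+ k.+1) i j = \sum_(t : k.-tuple 'I_n) walk_weight M i t j.
Proof.
elim: k i => [|k IH] i.
  rewrite expr1 (bigD1 [tuple]) //= big1 ?addr0 // => t /eqP[].
  exact: tuple0.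
rewrite exprS -mulmxE mxE sum_tupleS; apply: eq_bigr => l _.
by rewrite IH big_distrr.
Qed.

Lemma mxtrace_expr (R : comPzRingType) (n k : nat) (M : 'M[R]_n) :
  \tr (M ^+ k.+1) =
  \sum_(c : {ffun 'I_k.+1 -> 'I_n}) \prod_i M (c i) (c (ordS i)).
Proof.
rewrite (reindex finfun_of_tuple) /=; last first.
  by exists tuple_of_finfun => x _; rewrite ?finfun_of_tupleK ?tuple_of_finfunK.
rewrite sum_tupleS; apply: eq_bigr => i _; rewrite exprmx_walk.
apply: eq_bigr => t _; rewrite walk_weight_prod size_tuple.
apply: eq_bigr => l _; rewrite !ffunE !(tnth_nth i) /=; congr (M _ _).
have [ltl|] := ltnP l k; first by rewrite modn_small.
(* At the last index [ordS] wraps around to the starting vertex [i]; reading [t] past its end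
   returns the default, also [i]. *)
move=> lek; have -> : nat_of_ord l = k by apply/eqP; rewrite eqn_leq lek -ltnS ltn_ord.
by rewrite modnn nth_default ?size_tuple.
Qed.

(** * Norm inequalities for skew-symmetric matrices *)

Lemma cauchy_schwarz_sum (R : realFieldType) (I : finType) (x y : I -> R) :
  (\sum_i x i * y i) ^+ 2 <= (\sum_i x i ^+ 2) * (\sum_i y i ^+ 2).
Proof.
set b := \sum_i x i * y i; set a := \sum_i x i ^+ 2; set c := \sum_i y i ^+ 2.
(* Lagrange's identity: this sum of squares is twice the gap between the two sides. *)
have : 0 <= \sum_i \sum_j (x i * y j - x j * y i) ^+ 2.
  by apply: sumr_ge0 => i _; apply: sumr_ge0 => j _; apply: sqr_ge0.
have -> : \sum_i \sum_j (x i * y j - x j * y i) ^+ 2 = 2 * (a * c - b ^+ 2).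
  have -> : 2 * (a * c - b ^+ 2) = a * c + c * a - 2 * (b * b) by ring.
  rewrite !big_distrlr /= mulr_sumr -big_split -sumrB; apply: eq_bigr => i _ /=.
  rewrite mulr_sumr -big_split -sumrB; apply: eq_bigr => j _ /=; ring.
by lra.
Qed.

Section Skew.
Variables (R : realFieldType) (n : nat) (A : 'M[R]_n).
Hypothesis skewA : A^T = - A.

Lemma trmx_expr_skew m : (A ^+ m)^T = (-1) ^+ m *: A ^+ m.
Proof.
elim: m => [|m IH]; first by rewrite !expr0 scale1r trmx1.
rewrite [in LHS]exprSr -mulmxE trmx_mul IH skewA mulNmx -scalemxAr mulmxE -exprS.
by rewrite [in RHS]exprS mulN1r scaleNr.
Qed.

Definition sqnorm (y : 'cV[R]_n) : R := \sum_i y i 0 ^+ 2.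

Lemma sqnorm_ge0 y : 0 <= sqnorm y.
Proof. by apply: sumr_ge0 => i _; apply: sqr_ge0. Qed.

Lemma sqnormE y : sqnorm y = (y^T *m y) 0 0.
Proof. by rewrite mxE; apply: eq_bigr => i _; rewrite mxE. Qed.

Lemma dotmx_sqr_le (x y : 'cV[R]_n) :
  (x^T *m y) 0 0 ^+ 2 <= sqnorm x * sqnorm y.
Proof.
rewrite mxE; under eq_bigr do rewrite mxE.
exact: cauchy_schwarz_sum.
Qed.

(** The trace of [A ^+ m * A ^+ m] sums products of the [(i, j)] and [(j, i)] entries of [A ^+ m],
    which agree up to the global sign [(-1) ^+ m]. *)
Lemma norm_mxtrace_expr_even m :
  `|\tr (A ^+ m.*2)| = \sum_i \sum_j (A ^+ m) i j ^+ 2.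
Proof.
have -> : \tr (A ^+ m.*2) = (-1) ^+ m * \sum_i \sum_j (A ^+ m) i j ^+ 2.
  rewrite -addnn exprD -mulmxE mulr_sumr; apply: eq_bigr => i _.
  rewrite mxE mulr_sumr; apply: eq_bigr => j _.
  have := congr1 (fun M : 'M_n => M i j) (trmx_expr_skew m).
  by rewrite !mxE => ->; rewrite mulrCA expr2.
rewrite normrM normrX normrN1 expr1n mul1r ger0_norm //.
by apply: sumr_ge0 => i _; apply: sumr_ge0 => j _; apply: sqr_ge0.
Qed.

Lemma sqnorm_mulmx_le (B : 'M[R]_n) y :
  sqnorm (B *m y) <= (\sum_i \sum_j B i j ^+ 2) * sqnorm y.
Proof.
rewrite mulr_suml; apply: ler_sum => i _; rewrite mxE.
exact: cauchy_schwarz_sum.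
Qed.

Let moment y j := sqnorm (A ^+ j *m y).

(* [A] is skew, so [|A^(j+1) y|^2 = - <A^j y, A^(j+2) y>]. *)
Lemma moment_log_convex y j :
  moment y j.+1 ^+ 2 <= moment y j * moment y j.+2.
Proof.
have -> : moment y j.+1 = - ((A ^+ j *m y)^T *m (A ^+ j.+2 *m y)) 0 0.
  rewrite /moment sqnormE (exprS _ j.+1) {1}exprS -!mulmxE -!mulmxA (trmx_mul A).
  by rewrite skewA mulmxN mulNmx mxE mulmxA.
by rewrite sqrrN; apply: dotmx_sqr_le.
Qed.

(** By log-convexity the ratios of successive moments increase, so the first is the least. The
    product form also covers vanishing moments. *)
Lemma moment_ratio y j : moment y 1 * moment y j <= moment y 0 * moment y j.+1.
Proof.
have ge0 i : 0 <= moment y i by apply: sqnorm_ge0.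
elim: j => [|j IH]; first by rewrite mulrC.
have cvx := moment_log_convex y j.
have := ge0 j.+1; rewrite le_eqVlt => /predU1P[<-|gt0]; first by rewrite mulr0 mulr_ge0.
(* If this moment vanished, log-convexity would make the next one vanish too. *)
have gtj : 0 < moment y j.
  rewrite lt_def ge0 andbT; apply/eqP => e; move: cvx; rewrite e mul0r.
  by rewrite leNgt exprn_gt0.
rewrite -(ler_pM2r gtj).
apply: (@le_trans _ _ (moment y 0 * moment y j.+1 ^+ 2)).
  by rewrite mulrAC expr2 mulrA ler_wpM2r ?ge0.
by rewrite -mulrA [_ * moment y j]mulrC ler_wpM2l.
Qed.

(** Multiplying the ratio bounds telescopes: each of the [m.+1] ratios is at least the first. *)
Lemma moment_power_mean y m :
  sqnorm (A *m y) ^+ m.+1 <= sqnorm y ^+ m * sqnorm (A ^+ m.+1 *m y).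
Proof.
have e0 : moment y 0 = sqnorm y by rewrite /moment expr0 mul1mx.
have e1 : moment y 1 = sqnorm (A *m y) by [].
rewrite -e0 -e1 -/(moment y m.+1).
have ge0 i : 0 <= moment y i by apply: sqnorm_ge0.
elim: m => [|m IH]; first by rewrite expr1 expr0 mul1r.
rewrite exprS; apply: (le_trans (ler_wpM2l (ge0 1) IH)).
rewrite mulrCA (exprSr (moment y 0)) -mulrA ler_wpM2l ?exprn_ge0 ?ge0 //.
exact: moment_ratio.
Qed.

Lemma bilinear_pow_le_mxtrace (x y : 'cV[R]_n) m : (0 < m)%N ->
  (x^T *m (A *m y)) 0 0 ^+ m.*2 <=
  sqnorm x ^+ m * sqnorm y ^+ m * `|\tr (A ^+ m.*2)|.
Proof.
case: m => // m _; rewrite norm_mxtrace_expr_even.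
rewrite -mul2n exprM.
apply: (@le_trans _ _ ((sqnorm x * sqnorm (A *m y)) ^+ m.+1)).
  by rewrite lerXn2r ?nnegrE ?sqr_ge0 ?mulr_ge0 ?sqnorm_ge0 // dotmx_sqr_le.
rewrite exprMn -mulrA ler_wpM2l ?exprn_ge0 ?sqnorm_ge0 //.
apply: (le_trans (moment_power_mean y m)).
rewrite (exprSr (sqnorm y)) -mulrA ler_wpM2l ?exprn_ge0 ?sqnorm_ge0 // mulrC.
exact: sqnorm_mulmx_le.
Qed.

End Skew.

(** * Trace bounds for matrices with entries in [-1, 1] *)

Lemma expr_entry_le (R : realFieldType) (n : nat) (A : 'M[R]_n) :
  (forall i j, `|A i j| <= 1) ->
  forall p i j, `|(A ^+ p.+1) i j| <= n%:R ^+ p.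
Proof.
move=> A1; elim=> [|p IH] i j; first by rewrite expr1 expr0.
rewrite exprS -mulmxE mxE; apply: (le_trans (ler_norm_sum _ _ _)).
apply: (@le_trans _ _ (\sum_(l < n) n%:R ^+ p)).
  apply: ler_sum => l _; rewrite normrM -[leRHS]mul1r.
  by rewrite ler_pM.
by rewrite sumr_const card_ord exprS -[leLHS]mulr_natl.
Qed.

(** Cancellation is used only in the last two steps of a closed walk; the first [p.+1] steps are
    bounded entrywise by [n%:R ^+ p], and the sum over [l] gives one more factor [n]. *)
Lemma mxtrace_expr_le (R : realFieldType) (n : nat) (A : 'M[R]_n) (b : R) (p : nat) :
  (forall i j, `|A i j| <= 1) ->
  (forall l, \sum_i `|\sum_j A i j * A j l| <= b) ->
  `|\tr (A ^+ p.+3)| <= n%:R ^+ p.+1 * b.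
Proof.
move=> A1 Ab.
have -> : \tr (A ^+ p.+3) =
    \sum_l \sum_i (A ^+ p.+1) l i * \sum_j A i j * A j l.
  rewrite -addn2 exprD -mulmxE; apply: eq_bigr => l _; rewrite mxE.
  by apply: eq_bigr => i _; rewrite expr2 -mulmxE mxE.
apply: (le_trans (ler_norm_sum _ _ _)).
apply: (@le_trans _ _ (\sum_(l < n) n%:R ^+ p * b)); last first.
  by rewrite sumr_const card_ord exprS -mulrA -[leLHS]mulr_natl.
apply: ler_sum => l _; apply: (le_trans (ler_norm_sum _ _ _)).
apply: (@le_trans _ _ (\sum_i n%:R ^+ p * `|\sum_j A i j * A j l|)).
  by apply: ler_sum => i _; rewrite normrM ler_wpM2r ?expr_entry_le.
by rewrite -mulr_sumr ler_wpM2l ?exprn_ge0 ?ler0n.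
Qed.

(** * The sign matrix of a tournament *)

Section SignMatrix.
Variables (R : realType) (V : finType) (T : tournament V).
Let n := #|V|.

Lemma edge_rev u v : u != v -> T v u = ~~ T u v.
Proof. by move/(edge_xor T); case: (T u v) (T v u) => [] []. Qed.

Definition sgn (u v : V) : R := (T u v)%:R - (T v u)%:R.

(** In a product along a closed sequence, the first factor tests for a cycle and the second counts
    backward edges modulo 2. *)
Lemma sgn_signE u v : sgn u v = (u != v)%:R * (-1) ^+ (T v u).
Proof.
rewrite /sgn; have [->|uv] := eqVneq u v; first by rewrite subrr mul0r.
by rewrite (edge_rev uv) mul1r; case: (T u v); rewrite /= ?subr0 ?sub0r ?expr0 ?expr1.
Qed.

Lemma sgnC u v : sgn u v = - sgn v u.
Proof. by rewrite /sgn opprB. Qed.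

Lemma norm_sgn_le1 u v : `|sgn u v| <= 1.
Proof.
by rewrite sgn_signE normrM normr_sign mulr1; case: (u != v); rewrite ?normr0 ?normr1.
Qed.

Lemma sum_sgn v (Y : {set V}) :
  \sum_(y in Y) sgn v y = (outdeg T v Y)%:R - (indeg T v Y)%:R.
Proof.
have count (P : pred V) : (#|[set y in Y | P y]|)%:R = \sum_(y in Y) (P y)%:R :> R.
  rewrite -sum1_card natr_sum [LHS]big_mkcond [RHS]big_mkcond; apply: eq_bigr => y _.
  by rewrite inE; case: (y \in Y); case: (P y).
by rewrite /outdeg /indeg !count -sumrB.
Qed.

Definition sgnmx : 'M[R]_n := \matrix_(i, j) sgn (enum_val i) (enum_val j).

Lemma sgnmx_skew : sgnmx^T = - sgnmx.
Proof. by apply/matrixP => i j; rewrite !mxE sgnC. Qed.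

Lemma sum_enum_val (F : V -> R) : \sum_(i < n) F (enum_val i) = \sum_v F v.
Proof. by rewrite [RHS](reindex _ (onW_bij _ (@enum_val_bij V))). Qed.

(** Non-cycles contribute 0 and cycles their parity sign; even minus odd is twice the even ones
    minus all cycles. *)
Lemma mxtrace_sgnmx k : (0 < k)%N ->
  \tr (sgnmx ^+ k) =
  (ec k T)%:R *+ 2 - #|[set c : {ffun 'I_k -> V} | is_cycle c]|%:R.
Proof.
case: k => // k _; rewrite mxtrace_expr.
pose f (d : {ffun 'I_k.+1 -> 'I_n}) : {ffun 'I_k.+1 -> V} := [ffun i => enum_val (d i)].
pose g (c : {ffun 'I_k.+1 -> V}) : {ffun 'I_k.+1 -> 'I_n} := [ffun i => enum_rank (c i)].
transitivity (\sum_(c : {ffun 'I_k.+1 -> V}) \prod_i sgn (c i) (c (ordS i))).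
  rewrite [RHS](reindex f) /=; last first.
    exists g => c _; apply/ffunP => i; rewrite !ffunE ?enum_valK ?enum_rankK //.
  by apply: eq_bigr => d _; apply: eq_bigr => i _; rewrite mxE !ffunE.
rewrite /ec -!sum1_card !natr_sum -sumrMnl.
rewrite [X in _ = X - _]big_mkcond [X in _ = _ - X]big_mkcond -sumrB.
apply: eq_bigr => c _; rewrite !inE /even_cycle.
have [/forallP cyc|] := boolP (is_cycle c); last first.
  by case/forallPn => i /negPn e; rewrite (bigD1 i) //= sgn_signE e !mul0r subrr.
transitivity ((-1) ^+ odd (backward T c) : R); last first.
  by case: (odd _); rewrite /= ?expr0 ?expr1; ring.
rewrite signr_odd /backward -sum1_card [X in _ ^+ X]big_mkcond -prodrXr.
apply: eq_bigr => i _.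
by rewrite sgn_signE cyc mul1r inE; case: (T _ _).
Qed.

Lemma card_ffun_ord k : #|{ffun 'I_k -> V}| = (n ^ k)%N.
Proof. by rewrite card_ffun card_ord. Qed.

(** Union bound over the position [i] where [c i = c (ordS i)]: there, deleting coordinate [i] is
    injective, since the lost value survives at [ordS i]. *)
Lemma card_noncycles k : (1 < k)%N ->
  (n ^ k - #|[set c : {ffun 'I_k -> V} | is_cycle c]| <= k * n ^ k.-1)%N.
Proof.
case: k => [|[|k]] // _.
pose bad (i : 'I_k.+2) := [set c : {ffun 'I_k.+2 -> V} | c i == c (ordS i)].
have bad_le i : (#|bad i| <= n ^ k.+1)%N.
  rewrite -card_ffun_ord.
  pose r (c : {ffun 'I_k.+2 -> V}) := [ffun j : 'I_k.+1 => c (lift i j)].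
  apply: (@leq_card_in _ _ r) => c d; rewrite !inE => /eqP ci /eqP di rcd.
  have off j : i != j -> c j = d j.
    by case/unlift_some => j' -> _; have /ffunP/(_ j') := rcd; rewrite !ffunE.
  apply/ffunP => j; have [<-|/off//] := eqVneq i j; rewrite ci di off //.
  (* With at least two positions, [ordS i] differs from [i], whether or not it wraps around. *)
  apply/eqP => /(congr1 val) /=.
  have := ltn_ord i; rewrite ltnS leq_eqVlt => /predU1P[->|lti].
    by rewrite modnn.
  by rewrite modn_small //; apply/eqP; rewrite neq_ltn leqnn.
rewrite -card_ffun_ord -cardsT -cardsDS ?subsetT //.
apply: (@leq_trans (\sum_i #|bad i|)); last first.
  rewrite -[leqRHS]/(k.+2 * n ^ k.+1)%N -[X in (X * _)%N]card_ord -sum_nat_const.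
  exact: leq_sum.
apply: (@leq_trans #|\bigcup_i bad i|).
  rewrite setTD; apply/subset_leq_card/subsetP => c.
  by rewrite !inE => /forallPn[i /negPn ci]; apply/bigcupP; exists i; rewrite ?inE.
elim/big_rec2: _ => [|i a b _ le_ab]; first by rewrite cards0.
by rewrite (leq_trans (leq_card_setU _ _)) // leq_add2l.
Qed.

Lemma norm_mxtrace_sgnmx k : (1 < k)%N ->
  `|\tr (sgnmx ^+ k) - ((ec k T)%:R *+ 2 - n%:R ^+ k)| <= k%:R * n%:R ^+ k.-1.
Proof.
move=> k1; rewrite mxtrace_sgnmx ?(ltnW k1) //.
set C := #|_|.
have leC : (C <= n ^ k)%N by rewrite -card_ffun_ord max_card.
have -> : (ec k T)%:R *+ 2 - C%:R - ((ec k T)%:R *+ 2 - n%:R ^+ k) = (n ^ k - C)%:R :> R.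
  by rewrite natrB // natrX; ring.
by rewrite normr_nat -natrX -natrM ler_nat card_noncycles.
Qed.

Lemma norm_mxtrace_sgnmx_le (delta : R) k : (3 <= k)%N ->
  (forall X Y : {set V}, imbalance R T X Y <= delta * n%:R ^+ 2) ->
  `|\tr (sgnmx ^+ k)| <= 2 * delta * n%:R ^+ k.
Proof.
case: k => [|[|[|p]]] // _ balanced.
have -> : 2 * delta * n%:R ^+ p.+3 = n%:R ^+ p.+1 * (2 * (delta * n%:R ^+ 2)).
  by rewrite -[p.+3]addn2 exprD; ring.
apply: mxtrace_expr_le => [i j|l]; first by rewrite mxE norm_sgn_le1.
set w := enum_val l.
pose d v Y : R := (outdeg T v Y)%:R - (indeg T v Y)%:R.
(* The factor [sgn y w] is 1 on in-neighbours of [w] and -1 on out-neighbours, so the inner sum is a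
   difference of two signed degrees. Each costs one imbalance with [X = setT], whence the factor
   2. *)
have -> : \sum_i `|\sum_j sgnmx i j * sgnmx j l| =
    \sum_v `|d v [set y | T y w] - d v [set y | T w y]|.
  rewrite -sum_enum_val; apply: eq_bigr => i _; congr `|_|.
  under eq_bigr do rewrite !mxE.
  rewrite (sum_enum_val (fun y => sgn (enum_val i) y * sgn y w)) /d -!sum_sgn.
  rewrite [X in _ = X - _]big_mkcond [X in _ = _ - X]big_mkcond -sumrB.
  apply: eq_bigr => y _.
  by rewrite !inE [X in _ * X]/sgn; case: (T y w); case: (T w y) => /=; ring.
have leX Y : \sum_v `|d v Y| <= delta * n%:R ^+ 2.
  by rewrite (le_trans _ (balanced setT Y)) // /imbalance big_set.
rewrite mulr_natl mulr2n; apply: le_trans (lerD (leX _) (leX _)).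
by rewrite -big_split; apply: ler_sum => v _; apply: ler_normB.
Qed.

Lemma imbalance_pow_le m (X Y : {set V}) : (0 < m)%N ->
  imbalance R T X Y ^+ m.*2 <= n%:R ^+ m.*2 * `|\tr (sgnmx ^+ m.*2)|.
Proof.
move=> m0.
pose d v : R := (outdeg T v Y)%:R - (indeg T v Y)%:R.
(* The signs in [x] turn each signed degree into its absolute value, so the imbalance becomes a
   bilinear form. *)
pose x : 'cV[R]_n :=
  \col_i ((enum_val i \in X)%:R * (-1) ^+ (d (enum_val i) < 0)%R).
pose y : 'cV[R]_n := \col_j (enum_val j \in Y)%:R.
have -> : imbalance R T X Y = (x^T *m (sgnmx *m y)) 0 0.
  rewrite mxE /imbalance big_mkcond -sum_enum_val; apply: eq_bigr => i _.
  rewrite !mxE; under eq_bigr do rewrite !mxE.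
  rewrite (sum_enum_val (fun v => sgn (enum_val i) v * (v \in Y)%:R)).
  have -> : \sum_v sgn (enum_val i) v * (v \in Y)%:R = d (enum_val i).
    rewrite /d -sum_sgn [RHS]big_mkcond; apply: eq_bigr => v _.
    by case: (v \in Y); rewrite ?mulr1 ?mulr0.
  by rewrite -mulrA -normrEsign; case: (_ \in X); rewrite ?mul1r ?mul0r.
have sq_le1 (z : 'cV[R]_n) : (forall i, z i 0 ^+ 2 <= 1) -> sqnorm z <= n%:R.
  by move=> z1; rewrite -[n in n%:R]card_ord -sumr_const; apply: ler_sum.
apply: (le_trans (bilinear_pow_le_mxtrace sgnmx_skew x y m0)).
rewrite ler_wpM2r // -addnn exprD.
have pow_le z : sqnorm z <= n%:R -> sqnorm z ^+ m <= n%:R ^+ m.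
  by move=> zn; rewrite lerXn2r ?nnegrE ?sqnorm_ge0 ?ler0n.
apply: ler_pM; rewrite ?exprn_ge0 ?sqnorm_ge0 //; apply/pow_le/sq_le1 => i; rewrite mxE.
  by rewrite exprMn sqrr_sign mulr1; case: (_ \in X); rewrite ?expr0n ?expr1n ?ler01.
by case: (_ \in Y); rewrite ?expr0n ?expr1n ?ler01.
Qed.

End SignMatrix.

(** * Choice of constants and the equivalence *)

Lemma natmul_pow_le (R : realType) (k : nat) (eps : R) : (0 < k)%N -> 0 < eps ->
  exists n0 : nat, forall n, (n0 <= n)%N -> k%:R * n%:R ^+ k.-1 <= eps * n%:R ^+ k.
Proof.
move=> k0 eps0; exists (Num.Def.archi_bound (k%:R / eps)) => n le_n.
have : k%:R / eps <= n%:R.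
  apply: le_trans (_ : (Num.Def.archi_bound (k%:R / eps))%:R <= _); last by rewrite ler_nat.
  by apply/ltW/archi_boundP; rewrite divr_ge0 ?ler0n ?ltW.
rewrite ler_pdivrMr // => le_k.
rewrite -[in leRHS](prednK k0) exprS mulrA ler_wpM2r ?exprn_ge0 ?ler0n //.
by rewrite mulrC.
Qed.

Theorem theorem1p1 (R : realType) (k : nat) (hk : (4 <= k)%N) (hkeven : ~~ odd k) :
  (forall eps : R, 0 < eps ->
     exists2 delta : R, 0 < delta &
     exists n0 : nat, forall (V : finType) (T : tournament V),
       (n0 <= #|V|)%N ->
       (forall X Y : {set V}, imbalance R T X Y <= delta * #|V|%:R ^+ 2) ->
       `|(ec k T)%:R - 1 / 2 * #|V|%:R ^+ k| <= eps * #|V|%:R ^+ k)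
  /\
  (forall eps : R, 0 < eps ->
     exists2 delta : R, 0 < delta &
     exists n0 : nat, forall (V : finType) (T : tournament V),
       (n0 <= #|V|)%N ->
       `|(ec k T)%:R - 1 / 2 * #|V|%:R ^+ k| <= delta * #|V|%:R ^+ k ->
       forall X Y : {set V}, imbalance R T X Y <= eps * #|V|%:R ^+ 2).
Proof.
have k0 : (0 < k)%N by apply: leq_trans hk.
have k1 : (1 < k)%N by apply: leq_trans hk.
have k3 : (3 <= k)%N by apply: leq_trans hk.
split=> eps eps0.
  (* The trace and the non-cycles each contribute at most [eps * n ^ k] to the error in twice
     [ec]. *)
  exists (eps / 2); first by rewrite divr_gt0.
  have [n0 n0P] := natmul_pow_le k0 eps0; exists n0 => V T /n0P small balanced.
  have := norm_mxtrace_sgnmx R T k1; have := norm_mxtrace_sgnmx_le k3 balanced.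
  have -> : 2 * (eps / 2) = eps by field.
  by rewrite !ler_norml => /andP[? ?] /andP[? ?]; apply/andP; split; lra.
(* Of the three thirds, two pay for the error in twice [ec] and one for the non-cycles. *)
have d0 : 0 < eps ^+ k / 3 by rewrite divr_gt0 ?exprn_gt0.
exists (eps ^+ k / 3) => //.
have [n0 n0P] := natmul_pow_le k0 d0; exists n0 => V T /n0P small even_half X Y.
have tr_le : `|\tr (sgnmx R T ^+ k)| <= eps ^+ k * #|V|%:R ^+ k.
  move: even_half (norm_mxtrace_sgnmx R T k1).
  by rewrite !ler_norml => /andP[? ?] /andP[? ?]; apply/andP; split; lra.
have im0 : 0 <= imbalance R T X Y by apply: sumr_ge0.
(* Comparing [k]-th powers, the trace bound gives [n ^ k * (eps ^ k * n ^ k)], which is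
   [(eps * n ^ 2) ^ k]. *)
rewrite -(ler_pXn2r k0) ?nnegrE //; last by rewrite mulr_ge0 ?exprn_ge0 ?ler0n ?ltW.
have kE : k = k./2.*2 by rewrite even_halfK.
have half0 : (0 < k./2)%N by rewrite -double_gt0 -kE.
have := imbalance_pow_le R T X Y half0; rewrite -kE => /le_trans; apply.
rewrite exprMn -exprM mul2n -addnn exprD mulrCA.
by rewrite ler_wpM2l ?exprn_ge0 ?ler0n.
Qed.
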